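(* There is a non-locally compact, Weil complete Polish group $G$, having a free subgroup at $1$ and an open subgroup $U\leqslant G$ whose conjugates $fUf^{-1}$, $f\in G$, provide a neighbourhood basis at $1$.
   Context: A Polish group is a separable, completely metrisable topological group. A topological group is Weil complete if it is complete with respect to its left uniformity, i.e., the uniformity with fundamental system of entourages $\{(x,y)\in G\times G : x^{-1}y\in W\}$, with $W$ ranging over symmetric neighbourhoods of $1$; for Polish groups this means that there is a compatible complete left-invariant metric. A Polish group $G$ is said to have a free subgroup at $1$ if there is a sequence $g_n\in G$ converging to $1$ which is the basis of a free non-Abelian group and such that any finitely generated subgroup $\langle g_1,\ldots,g_n\rangle$ is discrete. *)

(* Defs.v *)
From HB Require Import structures.
From mathcomp Require Import all_boot all_order all_algebra.
From mathcomp Require Import all_classical all_reals.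
From mathcomp Require Import topology.

Set Implicit Arguments.
Unset Strict Implicit.
Unset Printing Implicit Defensive.

Local Open Scope classical_set_scope.
Local Open Scope group_scope.

HB.structure Definition PreTopologicalGroup := {G of Topological G & Group G}.

HB.mixin Record PreTopologicalGroup_isTopologicalGroup G
    & PreTopologicalGroup G := {
  mulg_continuous : continuous (fun x : G * G => x.1 * x.2) ;
  invg_continuous : continuous (fun x : G => x^-1)
}.

#[short(type="topologicalGroupType")]
HB.structure Definition TopologicalGroup :=
  {G of PreTopologicalGroup G & PreTopologicalGroup_isTopologicalGroup G}.

Definition separable (T : topologicalType) :=
  exists2 D : set T, countable D & dense D.

(* Convergence is written [exists x, F --> x] because [cvg F] would require a
   pointed type. *)
Definition complete_space (T : uniformType) :=
  forall F : set_system T, ProperFilter F -> cauchy F -> exists x : T, F --> x.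

Definition homeomorphic (S T : topologicalType) :=
  exists (f : S -> T) (g : T -> S),
    [/\ cancel f g, cancel g f, continuous f & continuous g].

Definition completely_metrizable (R : realType) (T : topologicalType) :=
  exists2 M : metricType R, complete_space M & homeomorphic T M.

Definition polish (R : realType) (T : topologicalType) :=
  separable T /\ completely_metrizable R T.

Section LeftUniformity.
Variable G : topologicalGroupType.

Definition left_entourage : set_system (G * G) :=
  filter_from
    [set W : set G | nbhs 1 W /\ (forall x, W x -> W x^-1)]
    (fun W => [set xy | W (xy.1^-1 * xy.2)]).

Lemma nbhs1_sym (W : set G) : nbhs 1 W ->
  nbhs 1 (W `&` [set x | W x^-1]) /\
  (forall x, (W `&` [set x | W x^-1]) x -> (W `&` [set x | W x^-1]) x^-1).
Proof.
move=> W1; split; last by move=> x [Wx /= WVx]; split=> //=; rewrite invgK.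
apply: filterI => //; have := @invg_continuous G 1 W; rewrite /= invg1.
exact.
Qed.

Lemma left_entourage_filter : Filter left_entourage.
Proof.
apply: filter_from_filter; first by exists setT; split=> //; exact: filterT.
move=> V W [V1 VV] [W1 WV]; exists (V `&` W) => //; split.
  exact: filterI.
by move=> x [Vx Wx]; split; [exact: VV | exact: WV].
Qed.

Lemma left_entourage_diagonal A : left_entourage A -> diagonal `<=` A.
Proof.
move=> [W [W1 _] WA] [x y] /= xy; apply: WA => /=.
have /= -> : x = y by [].
by rewrite mulVg; exact: nbhs_singleton.
Qed.

Lemma left_entourage_inv A : left_entourage A -> left_entourage A^-1%relation.
Proof.
move=> [W [W1 WV] WA]; exists W => // -[x y] /= Wxy; apply: WA => /=.
by have := WV _ Wxy; rewrite invgM invgK.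
Qed.

Lemma left_entourage_split_ex A : left_entourage A ->
  exists2 B, left_entourage B & (B \; B `<=` A)%relation.
Proof.
move=> [W [W1 _] WA].
have := @mulg_continuous G (1, 1) W; rewrite /= mulg1 => /(_ W1).
move=> [[V1 V2] /= [nV1 nV2] VW].
have [S1 SV] := nbhs1_sym (filterI nV1 nV2).
set S := _ `&` _ in S1 SV.
exists [set xy | S (xy.1^-1 * xy.2)]; first by exists S.
move=> [x z] [y /= [[Vxy _] _] [[_ Vyz] _]]; apply: WA => /=.
have -> : x^-1 * z = (x^-1 * y) * (y^-1 * z) by rewrite mulgA mulgK.
exact: (VW (_, _)).
Qed.

Lemma left_entourage_nbhsE : nbhs = nbhs_ left_entourage.
Proof.
apply/funext => x; apply/seteqP; split => A.
  move=> xA; have := @mulg_continuous G (x, 1) A; rewrite /= mulg1 => /(_ xA).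
  move=> [[V1 V2] /= [nV1 nV2] VA]; have [S1 SV] := nbhs1_sym nV2.
  set S := _ `&` _ in S1 SV.
  exists [set xy | S (xy.1^-1 * xy.2)]; first by exists S.
  move=> y /xsectionP /= [Vxy _].
  have -> : y = x * (x^-1 * y) by rewrite mulgA mulgV mul1g.
  by apply: (VA (_, _)); split => //=; exact: nbhs_singleton.
move=> [B [W [W1 _] WB] BA].
have := @mulg_continuous G (x^-1, x) W; rewrite /= mulVg => /(_ W1).
move=> [[V1 V2] /= [nV1 nV2] VW]; apply: filterS nV2 => y V2y.
apply/BA/xsectionP/WB/(VW (_, _)); split => //=; exact: nbhs_singleton.
Qed.

(* The carrier of G with its topology, as a uniform space for the left
   uniformity. *)
Definition left_uniform : Type := G.

HB.instance Definition _ := Topological.copy left_uniform G.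
HB.instance Definition _ := Nbhs_isUniform_mixin.Build left_uniform
  left_entourage_filter left_entourage_diagonal left_entourage_inv
  left_entourage_split_ex left_entourage_nbhsE.

End LeftUniformity.

Definition weil_complete (G : topologicalGroupType) :=
  complete_space (left_uniform G).

Section Subgroups.
Variable G : groupType.

Definition subgroup (H : set G) := group_closed [in H].

Definition generated (A : set G) : set G := smallest subgroup A.

(* f U f^-1; MathComp's [u ^ f] would be f^-1 u f. *)
Definition conjugate (U : set G) (f : G) : set G :=
  [set f * u * f^-1 | u in U].

(* A word over the letters g_i^{+1}, g_i^{-1}: (i, true) stands for g_i and
   (i, false) for its inverse. *)
Definition eval_word (I : Type) (g : I -> G) (w : seq (I * bool)) : G :=
  \prod_(a <- w) (if a.2 then g a.1 else (g a.1)^-1).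

Definition reduced (I : eqType) (w : seq (I * bool)) :=
  sorted (fun a b => ~~ ((a.1 == b.1) && (a.2 != b.2))) w.

(* The family g is a basis of the subgroup that it generates, which is then
   free: no nonempty reduced word in g is trivial. *)
Definition free_basis (I : eqType) (g : I -> G) :=
  forall w : seq (I * bool), reduced w -> w <> [::] -> eval_word g w <> 1.

End Subgroups.

Definition discrete_subset (T : topologicalType) (A : set T) :=
  A `<=` isolated A.

Definition free_subgroup_at_1 (G : topologicalGroupType) :=
  exists g : nat -> G,
    [/\ g @ \oo --> (1 : G),
        free_basis g,
        (exists x y, [/\ generated (range g) x, generated (range g) y
                       & ~ commute x y])
      & forall n : nat, discrete_subset (generated (g @` `I_n))].

(* Main.v *)
From HB Require Import structures.
Require Import Defs.
From mathcomp Require Import all_boot all_order all_algebra.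
From mathcomp Require Import all_classical all_reals.
From mathcomp Require Import topology.
From mathcomp Require Import zify.

Local Open Scope classical_set_scope.
Local Open Scope group_scope.

(** Let D be the free group on x_0, x_1, x_2, ..., and let H be the group of all
functions f : Z -> D such that f(k) = 1 for all sufficiently negative k. The
group Z acts on H by shifting the argument; G is the semidirect product of H
and Z, a wreath product of D and Z whose lamps may stay lit arbitrarily far to
the right. The subgroups
   U_n = { (f, 0) : f(k) = 1 for all k < n }
are the neighbourhoods of 1 that define the topology. Here U_0 is D^N with the
product topology, D being discrete.

A descending sequence of subgroups defines a group topology as soon as for all g
and n the conjugate of some U_m by g lies in U_n. The left cosets of U_n are
then the balls of a left-invariant ultrametric, so completeness for that metric
and completeness for the left uniformity are both the statement that a
decreasing sequence of cosets x_n U_n has a common point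
([chain_complete_filter]). In G it has one since the n-th coset fixes the shift
and the lamps left of position n, up to a translation ([wreath_complete]).
Separability holds since D is countable ([finite_wreath_dense]), and local
compactness fails since U_(n+1) has infinite index in U_n
([chain_not_locally_compact]).

Translating by n conjugates U_0 to U_n, so the conjugates of the single open
subgroup U_0 form a neighbourhood basis at 1 ([wreath_conjugates]).

For the free subgroup, let g_i be the element of U_i equal to x_i at all
positions k >= i. At position n a word in g_0, ..., g_n takes the value of the
same word in x_0, ..., x_n, and D is free on the x_i
([lamp_free_lift_free_seq]). Hence the g_i form a free basis, and an element of
the group generated by g_0, ..., g_(n-1) is determined by its value at n, that
is, by its coset of U_(n+1); so that group is discrete. *)

Set Implicit Arguments.
Unset Strict Implicit.
Unset Printing Implicit Defensive.

Import Order.TTheory GRing.Theory Num.Theory.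

(** * Free groups as groups of reduced words *)

Arguments reduced : simpl never.

Section Words.
Variable I : eqType.
Implicit Types (a b : I * bool) (u v w : seq (I * bool)).

Definition flip a := (a.1, ~~ a.2).

Definition cancels a b := (a.1 == b.1) && (a.2 != b.2).

(** Left multiplication of a reduced word by one letter. The product of words
below iterates it; every group law reduces to the fact that [push a] and [push
(flip a)] are mutually inverse on reduced words. *)
Definition push a w :=
  if w is b :: w' then if cancels a b then w' else a :: w else [:: a].

Definition wmul u v := foldr push v u.

Definition winv w := rev (map flip w).

Lemma flipK : involutive flip.
Proof. by case=> i e; rewrite /flip negbK. Qed.

Lemma cancelsP a b : reflect (b = flip a) (cancels a b).
Proof.
case: a b => [i d] [j e].
apply: (iffP andP) => [[/= /eqP-> dNe]|[-> ->]] /=; last by case: d.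
by congr pair; case: d e dNe => -[].
Qed.

Lemma reduced_cons a w :
  reduced (a :: w) =
    (if w is b :: _ then ~~ cancels a b else true) && reduced w.
Proof. by case: w. Qed.

Lemma push_id a w : reduced (a :: w) -> push a w = a :: w.
Proof. by rewrite reduced_cons; case: w => //= b w /andP[/negPf->]. Qed.

Lemma push_reduced a w : reduced w -> reduced (push a w).
Proof.
case: w => // b w redw /=; case: ifPn => [_|nab].
  by move: redw; rewrite reduced_cons => /andP[].
by rewrite reduced_cons nab.
Qed.

Lemma push_flip a w : reduced w -> push a (push (flip a) w) = w.
Proof.
case: w => [|b w] redw /=; first by rewrite ifT //; exact/cancelsP.
case: ifPn => [/cancelsP|_] /=; last by rewrite ifT //; exact/cancelsP.
by rewrite flipK => eba; rewrite -eba push_id.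
Qed.

Lemma wmul_reduced u v : reduced v -> reduced (wmul u v).
Proof. by move=> redv; elim: u => //= a u; exact: push_reduced. Qed.

(** When [push a] cancels the head of [u], the two sides differ by the step
[push a (push (flip a) _)], which is the identity on reduced words. *)
Lemma wmul_push a u v : reduced v -> wmul (push a u) v = push a (wmul u v).
Proof.
move=> redv; case: u => //= b u; case: ifPn => // /cancelsP -> /=.
by rewrite push_flip // wmul_reduced.
Qed.

Lemma wmulA u v w : reduced w -> wmul u (wmul v w) = wmul (wmul u v) w.
Proof. by move=> redw; elim: u => //= a u ->; rewrite wmul_push. Qed.

Lemma wmul_nil w : reduced w -> wmul w [::] = w.
Proof.
elim: w => //= a w IHw redw; rewrite IHw ?push_id //.
by move: redw; rewrite reduced_cons => /andP[].
Qed.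

Lemma winvK : involutive winv.
Proof. by move=> w; rewrite /winv map_rev revK mapK //; exact: flipK. Qed.

Lemma winv_reduced w : reduced w -> reduced (winv w).
Proof.
rewrite /winv /reduced rev_sorted sorted_map; apply: sub_sorted => a b.
by rewrite /= (inj_eq negb_inj) eq_sym [b.2 == _]eq_sym.
Qed.

Lemma wmulV w : wmul (winv w) w = [::].
Proof.
elim: w => // a w IHw; rewrite -[RHS]IHw /wmul /winv /= rev_cons foldr_rcons /=.
by rewrite ifT //; apply/cancelsP; rewrite flipK.
Qed.

End Words.

Record free_group (I : eqType) :=
  FreeGroup { word : seq (I * bool); word_reduced : reduced word }.

HB.instance Definition _ (I : eqType) := [isSub for @word I].
HB.instance Definition _ (I : eqType) := [Equality of free_group I by <:].
HB.instance Definition _ (I : choiceType) := [Choice of free_group I by <:].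
HB.instance Definition _ (I : countType) := [Countable of free_group I by <:].

Section FreeGroup.
Variable I : choiceType.
Implicit Types x y z : free_group I.

Definition free_one : free_group I := FreeGroup (isT : reduced [::]).
Definition free_mul x y := FreeGroup (wmul_reduced (word x) (word_reduced y)).
Definition free_inv x := FreeGroup (winv_reduced (word_reduced x)).

Fact free_mulA : associative free_mul.
Proof. by move=> x y z; apply: val_inj; rewrite /= wmulA // word_reduced. Qed.

Fact free_mul1x : left_id free_one free_mul.
Proof. by move=> x; exact: val_inj. Qed.

Fact free_mulx1 : right_id free_one free_mul.
Proof. by move=> x; apply: val_inj; rewrite /= wmul_nil // word_reduced. Qed.

Fact free_mulVx : left_inverse free_one free_inv free_mul.
Proof. by move=> x; apply: val_inj; exact: wmulV. Qed.

Fact free_mulxV : right_inverse free_one free_inv free_mul.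
Proof.
by move=> x; apply: val_inj; rewrite /= -{1}[word x]winvK; exact: wmulV.
Qed.

HB.instance Definition _ :=
  isGroup.Build (free_group I)
    free_mulA free_mul1x free_mulx1 free_mulVx free_mulxV.

Definition gen (i : I) : free_group I :=
  FreeGroup (isT : reduced [:: (i, true)]).

(** Freeness of the generators: a reduced word is recovered from its value. *)
Lemma eval_word_gen w : reduced w -> word (eval_word gen w) = w.
Proof.
move=> redw; rewrite -[RHS](wmul_nil redw) /eval_word.
elim: w {redw} => [|[i e] w IHw]; first by rewrite big_nil.
by rewrite big_cons; case: e => /=; rewrite IHw.
Qed.

Section Lift.
Variables (G : groupType) (g : I -> G).

(** The homomorphism given by the universal property; [free_basis g] says that
its kernel is trivial. *)
Definition free_lift x := eval_word g (word x).

Lemma eval_word_push a w :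
  eval_word g (push a w) = eval_word g [:: a] * eval_word g w.
Proof.
rewrite /eval_word big_seq1; case: w => [|b w] /=.
  by rewrite big_seq1 big_nil mulg1.
case: ifPn => [/cancelsP -> |_]; last by rewrite !big_cons.
by rewrite big_cons; case: a => i [] /=; rewrite mulgA ?mulgV ?mulVg mul1g.
Qed.

Lemma free_liftM : {morph free_lift : x y / x * y}.
Proof.
move=> x y; rewrite /free_lift [word (x * y)]/=.
elim: (word x) => [|a w IHw] /=; first by rewrite [X in _ = X * _]big_nil mul1g.
rewrite eval_word_push IHw [in RHS]/eval_word big_cons.
by rewrite /eval_word big_seq1 mulgA.
Qed.

Lemma free_lift1 : free_lift 1 = 1.
Proof. exact: big_nil. Qed.

Lemma free_liftV : {morph free_lift : x / x^-1}.
Proof.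
move=> x; apply: (mulgI (free_lift x)).
by rewrite -free_liftM !mulgV free_lift1.
Qed.

Lemma all_push (P : pred I) a w :
  P a.1 -> all (P \o fst) w -> all (P \o fst) (push a w).
Proof.
case: w => /= [|b w] Pa; first by rewrite Pa.
by case: ifP => _ /andP[]; rewrite /= ?Pa // => ->.
Qed.

(** Cancellation introduces no new letters, so the reduced words in a given set of
letters form a subgroup of the free group, and so do their values. *)
Lemma generated_free_lift (P : pred I) :
  generated (g @` [set` P]) `<=`
    [set free_lift x | x in [set x | all (P \o fst) (word x)]].
Proof.
apply: smallest_sub => [|_ [i Pi <-]]; last first.
  by exists (gen i); rewrite /= ?andbT // /free_lift /eval_word big_seq1.
split=> [|_ _ /set_mem[x Px <-] /set_mem[y Py <-]]; apply/mem_set.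
  by exists 1; rewrite ?free_lift1.
exists (x / y); last by rewrite free_liftM free_liftV.
move: Px Py => /= Px; rewrite -(all_map fst) => Py.
have: all P (map fst (winv (word y))).
  by rewrite /winv map_rev all_rev -map_comp.
rewrite all_map; elim: (word x) Px => //= a w IHw /andP[Pa /IHw{}IHw] Pw.
exact: all_push (IHw Pw).
Qed.

End Lift.

End FreeGroup.

(** * Group topologies given by a descending chain of subgroups *)

Record subgroup_chain (G : groupType) := SubgroupChain {
  chain :> nat -> set G;
  chain_subgroup : forall n, subgroup (chain n);
  chain_decr : forall n, chain n.+1 `<=` chain n;
  chain_conj : forall (g : G) n,
    exists m, forall u, chain m u -> chain n (u ^ g)
}.

Section ChainTheory.
Variables (G : groupType) (U : subgroup_chain G).
Implicit Types (x y z : G) (n m : nat).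

Lemma chain1 n : U n 1.
Proof. by have [/set_mem] := chain_subgroup U n. Qed.

Lemma chainV n x : U n x -> U n x^-1.
Proof.
by move=> /mem_set/(group_closedV (chain_subgroup U n))/set_mem.
Qed.

Lemma chainM n x y : U n x -> U n y -> U n (x * y).
Proof.
move=> /mem_set Ux /mem_set Uy.
exact/set_mem/(group_closedM (chain_subgroup U n)).
Qed.

Lemma chain_le n m : (n <= m)%N -> U m `<=` U n.
Proof.
move=> /subnK <-; elim: (m - n)%N => // k IHk x /chain_decr; exact: IHk.
Qed.

Definition coset n x := [set y | U n (x^-1 * y)].

Lemma coset_refl n x : coset n x x.
Proof. by rewrite /coset /= mulVg; exact: chain1. Qed.

Lemma coset_sym n x y : coset n x y -> coset n y x.
Proof. by move/chainV; rewrite invgM invgK. Qed.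

Lemma coset_trans n x y z : coset n x y -> coset n y z -> coset n x z.
Proof. by move=> xy yz; have := chainM xy yz; rewrite mulgA mulgK. Qed.

Lemma coset_le n m x : (n <= m)%N -> coset m x `<=` coset n x.
Proof. by move=> nm y; exact: chain_le. Qed.

(** The [let] keeps [U] as a parameter, so that the topology attached to the
type is the one defined by [U]. *)
Definition chain_group : Type := let _ := U in G.

HB.instance Definition _ := Group.copy chain_group G.

Definition chain_nbhs (x : chain_group) : set_system chain_group :=
  filter_from setT (coset ^~ x).

HB.instance Definition _ := hasNbhs.Build chain_group chain_nbhs.

Fact chain_nbhs_filter (x : chain_group) : ProperFilter (nbhs x).
Proof.
apply: filter_from_proper => [|n _]; last by exists x; exact: coset_refl.
apply: filter_from_filter => [|n m _ _]; first by exists 0%N.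
exists (maxn n m) => // y xy; split; apply: coset_le xy.
  exact: leq_maxl.
exact: leq_maxr.
Qed.

Fact chain_nbhs_singleton (x : chain_group) A : nbhs x A -> A x.
Proof. by move=> [n _]; apply; exact: coset_refl. Qed.

Fact chain_nbhs_nbhs (x : chain_group) A : nbhs x A -> nbhs x (nbhs^~ A).
Proof.
move=> [n _ nA]; exists n => // y xy; exists n => // z yz.
exact/nA/(coset_trans xy).
Qed.

HB.instance Definition _ := Nbhs_isNbhsTopological.Build chain_group
  chain_nbhs_filter chain_nbhs_singleton chain_nbhs_nbhs.

Lemma nbhs_coset n (x : chain_group) : nbhs x (coset n x : set chain_group).
Proof. by exists n. Qed.

Fact chain_mulg_continuous :
  continuous (fun x : chain_group * chain_group => x.1 * x.2).
Proof.
move=> [x y] /= A [n _ nA]; have [m mn] := chain_conj U y n.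
exists (coset m x, coset n y); first by split; exact: nbhs_coset.
move=> [x' y'] /= [xx' yy']; apply: nA; rewrite /coset /=.
have -> : (x * y)^-1 * (x' * y') = (x^-1 * x') ^ y * (y^-1 * y').
  by rewrite conjgE invgM !mulgA mulgK.
by apply: chainM => //; exact: mn.
Qed.

Fact chain_invg_continuous : continuous (fun x : chain_group => x^-1).
Proof.
move=> x A [n _ nA]; have [m mn] := chain_conj U x^-1 n.
exists m => // y xy; apply: nA; rewrite /coset /= invgK.
by have := mn _ (chainV xy); rewrite conjgE invgM !invgK mulgK.
Qed.

HB.instance Definition _ := PreTopologicalGroup_isTopologicalGroup.Build
  chain_group chain_mulg_continuous chain_invg_continuous.

Lemma chain_subgroup_open n : open (U n : set chain_group).
Proof.
rewrite openE => x Ux; exists n => // y xy.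
by rewrite -[y]mul1g -[1](mulgV x) -mulgA; exact: chainM.
Qed.

Lemma nbhs1_chain n : nbhs (1 : chain_group) (U n).
Proof. by exists n => // x; rewrite /coset /= invg1 mul1g. Qed.

Lemma cvg_chain T (F : set_system T) (f : T -> chain_group) (x : chain_group) :
  Filter F -> (forall n, \forall t \near F, coset n x (f t)) -> f @ F --> x.
Proof. by move=> FF xF A [n _ nA]; apply: filterS (xF n) => t /nA. Qed.

(** All conjugates of [U 0] are neighbourhoods of 1 by [chain_conj], so it is
enough that they are cofinal in the chain. *)
Lemma nbhs1_conjugates : (forall n, exists f, conjugate (U 0) f `<=` U n) ->
  nbhs (1 : chain_group) = filter_from setT (conjugate (U 0)).
Proof.
move=> conjU; apply/seteqP; split => A [].
  move=> n _ nA; have [f fn] := conjU n; exists f => // x /fn Ux.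
  by apply: nA; rewrite /coset /= invg1 mul1g.
move=> f _ fA; have [m mU] := chain_conj U f 0.
exists m => // x; rewrite /coset /= invg1 mul1g => /mU Uxf; apply: fA.
by exists (x ^ f) => //; rewrite conjgE !mulgA mulgV mul1g mulgK.
Qed.

Lemma chain_separable (D : set G) : countable D ->
  (forall x n, exists2 d, D d & coset n x d) -> separable chain_group.
Proof.
move=> cD denseD; exists D => // O [x Ox]; rewrite openE => /(_ x Ox)[n _ nO].
by have [d Dd xd] := denseD x n; exists d; split; [exact: nO|].
Qed.

(** A compact neighbourhood of 1 would contain infinitely many points in
distinct cosets of some [U m], and these cannot accumulate: a cluster point
would have two of them in its own coset. *)
Lemma chain_not_locally_compact :
  (forall n, exists2 z : nat -> G, (forall i, U n (z i)) &
     exists m, forall i j, coset m (z i) (z j) -> i = j) ->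
  ~ locally_compact [set: chain_group].
Proof.
move=> infU /(_ 1 I)[K [n _ nK] [cK _]].
have [z zU [m zm]] := infU n.
have FK : (z @ \oo) K.
  by exists 0%N => // i _; apply: nK => //; rewrite /coset /= invg1 mul1g.
have [x [_ zx]] := cK _ _ FK.
have zinf N : exists2 i, (N <= i)%N & coset m x (z i).
  have FN : (z @ \oo) [set z i | i in [set i | (N <= i)%N]].
    by exists N => // i Ni; exists i.
  have [_ [[i Ni <-] xz]] := zx _ _ FN (nbhs_coset m x).
  by exists i.
have [i _ xi] := zinf 0%N; have [j ij xj] := zinf i.+1.
have := zm i j (coset_trans (coset_sym xi) xj).
by move=> eij; rewrite eij ltnn in ij.
Qed.

(** Cauchy sequences that have been thinned out: the n-th term already
determines the coset of [U n] in which the limit lies. *)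
Definition chain_complete := forall x : nat -> G,
  (forall n, coset n (x n) (x n.+1)) -> exists y, forall n, coset n (x n) y.

Lemma coherent_coset (x : nat -> G) : (forall n, coset n (x n) (x n.+1)) ->
  forall n m, (n <= m)%N -> coset n (x n) (x m).
Proof.
move=> xS n m /subnK <-; elim: (m - n)%N => [|k IHk]; first exact: coset_refl.
by apply: coset_trans IHk _; apply: coset_le (xS _); exact: leq_addl.
Qed.

(** The common core of both completeness statements: the hypothesis on [F] is
what being Cauchy means for the left uniformity as well as for the metric. *)
Lemma chain_complete_filter (F : set_system G) : chain_complete ->
  ProperFilter F -> (forall n, exists x, F (coset n x)) ->
  exists y, forall n, F (coset n y).
Proof.
move=> cpl FF /choice[x xF].
have [n|y xy] := cpl x.
  have [z [nz /coset_sym/(coset_le (leqnSn n)) zSn]] :=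
    filter_ex (filterI (xF n) (xF n.+1)).
  exact: coset_trans zSn.
exists y => n; apply: filterS (xF n) => z; exact/coset_trans/coset_sym.
Qed.

Lemma chain_weil_complete : chain_complete -> weil_complete chain_group.
Proof.
move=> cpl F FF cF; have [n|y yF] := chain_complete_filter cpl FF.
  have [|[A B] /= [FA FB] AB] := cF [set xy | coset n xy.1 xy.2].
    exists (U n) => //; split; first exact: nbhs1_chain.
    by move=> x; exact: chainV.
  have [x Ax] := filter_ex FA.
  by exists x; apply: filterS FB => z Bz; exact: (AB (x, z)).
by exists y => A [n _ nA]; exact: filterS (yF n).
Qed.

End ChainTheory.

(** * The left-invariant ultrametric of a chain *)

Section ChainMetric.
Variables (R : realType) (G : groupType) (U : subgroup_chain G).
Hypothesis separated : forall x, (forall n, U n x) -> x = 1.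
Implicit Types (x y z : G) (n m : nat).

(** The distance is 1 / (n + 1) for the least n such that x and y lie in
distinct left cosets of [U n]; thus the ball of radius 1 / (n + 1) is a coset of
[U n]. *)
Definition chain_dist x y : R :=
  if pselect (exists n, `[< ~ coset U n x y >]) is left e
  then (ex_minn e).+1%:R^-1%R else 0%R.

Lemma chain_dist_lt n x y :
  (chain_dist x y < n.+1%:R^-1)%R = `[< coset U n x y >].
Proof.
rewrite /chain_dist; case: pselect => [e|ne]; last first.
  rewrite invr_gt0 ltr0Sn; apply/esym/asboolP.
  by apply: contra_notP ne => nxy; exists n; exact/asboolP.
case: ex_minnP => k /asboolP kxy kmin.
rewrite ltf_pV2 ?posrE ?ltr0Sn // ltr_nat ltnS.
apply/idP/asboolP => [nk|nxy].
  by apply: contrapT => /asboolP/kmin; rewrite leqNgt nk.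
by rewrite ltnNge; apply/negP => kn; apply: kxy; exact: coset_le nxy.
Qed.

Lemma chain_dist_ge0 x y : (0 <= chain_dist x y)%R.
Proof.
by rewrite /chain_dist; case: pselect => // e; rewrite invr_ge0 ler0n.
Qed.

Lemma chain_dist_le x y (e : R) : (0 <= e)%R ->
  (forall n, ~ coset U n x y -> n.+1%:R^-1 <= e)%R -> (chain_dist x y <= e)%R.
Proof.
rewrite /chain_dist; case: pselect => // ? _; apply.
by case: ex_minnP => k /asboolP.
Qed.

Lemma chain_dist_eq0 x y : chain_dist x y = 0%R <-> x = y.
Proof.
split=> [d0|->]; last first.
  apply/le_anti; rewrite chain_dist_ge0 andbT.
  by apply: chain_dist_le => // n []; exact: coset_refl.
apply/esym/(mulgI x^-1); rewrite mulVg; apply: separated => n.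
by have := chain_dist_lt n x y; rewrite d0 invr_gt0 ltr0Sn => /esym/asboolP.
Qed.

Lemma chain_dist_sym x y : chain_dist x y = chain_dist y x.
Proof.
wlog suff le_sym : x y / (chain_dist x y <= chain_dist y x)%R.
  by apply/le_anti; rewrite !le_sym.
apply: chain_dist_le; first exact: chain_dist_ge0.
move=> n nxy; rewrite leNgt chain_dist_lt; apply/negP => /asboolP.
by move/coset_sym.
Qed.

(** If the cosets of x and z for [U n] differ, then y misses one of them, so
that one of the two summands alone is at least 1 / (n + 1). *)
Lemma chain_dist_triangle y x z :
  (chain_dist x z <= chain_dist x y + chain_dist y z)%R.
Proof.
apply: chain_dist_le => [|n nxz]; first by rewrite addr_ge0 // chain_dist_ge0.
have [|nxy] := ltP (chain_dist x y) (n.+1%:R^-1)%R; last first.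
  by rewrite (le_trans nxy) // lerDl chain_dist_ge0.
rewrite chain_dist_lt => /asboolP xy.
rewrite (@le_trans _ _ (chain_dist y z)) ?lerDr ?chain_dist_ge0 //.
rewrite leNgt chain_dist_lt; apply/negP => /asboolP yz.
exact/nxz/(coset_trans xy).
Qed.

Definition chain_metric : Type := let _ := (R, separated) in G.

HB.instance Definition _ := Choice.on chain_metric.
HB.instance Definition _ := @isMetric.Build R chain_metric chain_dist
  (fun x => (chain_dist_eq0 x x).2 erefl) (fun x y => (chain_dist_eq0 x y).1)
  chain_dist_sym chain_dist_triangle.

Lemma ball_coset n x :
  @ball R chain_metric x (n.+1%:R^-1)%R = coset U n x.
Proof.
rewrite ballEmdist; apply/seteqP; split => y; rewrite /= chain_dist_lt.
  by move/asboolP.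
by move=> ?; apply/asboolP.
Qed.

Lemma coset_in_ball x (e : R) : (0 < e)%R ->
  exists n, coset U n x `<=` @ball R chain_metric x e.
Proof.
move=> e0; exists (Num.truncn e^-1)%R; rewrite -ball_coset.
apply: (@le_ball R chain_metric).
rewrite -[leRHS]invrK lef_pV2 ?posrE ?invr_gt0 ?ltr0Sn //.
by rewrite ltW // Num.Theory.truncnS_gt.
Qed.

Lemma nbhs_chain_metric (x : G) :
  nbhs (x : chain_metric) = nbhs (x : chain_group U).
Proof.
apply/seteqP; split => A.
  move=> /nbhs_ballP[e /= /(coset_in_ball x)[n ne] eA].
  by exists n => // y /ne /eA.
move=> [n _ nA]; apply/nbhs_ballP; exists (n.+1%:R^-1)%R.
  by rewrite /= invr_gt0 ltr0Sn.
by rewrite ball_coset.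
Qed.

Lemma chain_completely_metrizable :
  chain_complete U -> completely_metrizable R (chain_group U).
Proof.
move=> cpl; exists chain_metric.
  move=> F FF /cauchyP cF.
  have [n|y yF] := chain_complete_filter cpl FF.
    have [|x] := cF (n.+1%:R^-1)%R; first by rewrite invr_gt0 ltr0Sn.
    by rewrite ball_coset; exists x.
  exists y => A; rewrite nbhs_chain_metric => -[n _ nA].
  exact: filterS (yF n).
exists id, id; split=> // x A.
  by rewrite nbhs_chain_metric.
by rewrite /= -nbhs_chain_metric.
Qed.

End ChainMetric.

(** * The wreath product with lamps bounded below *)

Definition bounded_below (D : groupType) (f : int -> D) : Prop :=
  exists N : int, forall k, (k < N)%R -> f k = 1.

Record wreath (D : groupType) := Wreath {
  lamp : int -> D;
  shift : int;
  lamp_bounded : bounded_below lamp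
}.

HB.instance Definition _ (D : groupType) := gen_eqMixin (wreath D).
HB.instance Definition _ (D : groupType) := gen_choiceMixin (wreath D).

Section Wreath.
Variable D : groupType.
Implicit Types x y z : wreath D.

Lemma wreathP x y : shift x = shift y -> lamp x =1 lamp y -> x = y.
Proof.
case: x y => [f m bf] [g n bg] /= -> /funext fg.
by case: g / fg bg => bg; congr Wreath; exact: Prop_irrelevance.
Qed.

Fact wreath_one_bounded : bounded_below (fun _ => 1 : D).
Proof. by exists 0%R. Qed.

Definition wreath_one := Wreath 0%R wreath_one_bounded.

Fact wreath_mul_bounded x y :
  bounded_below (fun k => lamp x k * lamp y (k - shift x)%R).
Proof.
have [[M Mx] [N Ny]] := (lamp_bounded x, lamp_bounded y).
exists (Num.min M (N + shift x)%R) => k; rewrite lt_min => /andP[kM kN].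
by rewrite Mx // Ny ?mulg1 // ltrBlDr.
Qed.

Definition wreath_mul x y :=
  Wreath (shift x + shift y)%R (wreath_mul_bounded x y).

Fact wreath_inv_bounded x :
  bounded_below (fun k => (lamp x (k + shift x)%R)^-1).
Proof.
have [N Nx] := lamp_bounded x; exists (N - shift x)%R => k kN.
by rewrite Nx ?invg1 // -ltrBrDr.
Qed.

Definition wreath_inv x := Wreath (- shift x)%R (wreath_inv_bounded x).

Fact wreath_mulA : associative wreath_mul.
Proof.
move=> x y z; apply: wreathP => [|k] /=; first by rewrite addrA.
by rewrite mulgA opprD addrA.
Qed.

Fact wreath_mul1x : left_id wreath_one wreath_mul.
Proof.
by move=> x; apply: wreathP => [|k] /=; rewrite ?add0r ?subr0 ?mul1g.
Qed.

Fact wreath_mulx1 : right_id wreath_one wreath_mul.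
Proof. by move=> x; apply: wreathP => [|k] /=; rewrite ?addr0 ?mulg1. Qed.

Fact wreath_mulVx : left_inverse wreath_one wreath_inv wreath_mul.
Proof.
move=> x; apply: wreathP => [|k] /=; first by rewrite addNr.
by rewrite opprK mulVg.
Qed.

Fact wreath_mulxV : right_inverse wreath_one wreath_inv wreath_mul.
Proof.
move=> x; apply: wreathP => [|k] /=; first by rewrite subrr.
by rewrite subrK mulgV.
Qed.

HB.instance Definition _ :=
  isGroup.Build (wreath D)
    wreath_mulA wreath_mul1x wreath_mulx1 wreath_mulVx wreath_mulxV.

(** The lower bound is a natural number: in this range the subgroups already
form a neighbourhood basis at 1. *)
Definition trivial_below (n : nat) : set (wreath D) :=
  [set x | shift x = 0%R /\ forall k : int, (k < n%:Z)%R -> lamp x k = 1].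

Lemma trivial_below_subgroup n : subgroup (trivial_below n).
Proof.
split=> [|x y /set_mem[sx lx] /set_mem[sy ly]]; first exact/mem_set.
apply/mem_set; split=> [|k kn] /=; rewrite sx sy ?subr0 //.
by rewrite lx // ly // divg1.
Qed.

Lemma trivial_below_decr n : trivial_below n.+1 `<=` trivial_below n.
Proof. by move=> x [sx lx]; split=> // k kn; apply: lx; lia. Qed.

(** Conjugating by an element translates the lamps by its shift; the lamps of
[x] only conjugate each value inside [D]. *)
Lemma trivial_belowJ m n x u : (n%:Z + shift x <= m%:Z)%R ->
  trivial_below m u -> trivial_below n (u ^ x).
Proof.
move=> nm [su lu]; rewrite conjgE; split=> [|k kn] /=.
  by rewrite su; lia.
by rewrite su lu ?mul1g; [rewrite !opprK subr0 mulVg | lia].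
Qed.

Lemma trivial_below_conj x n :
  exists m, forall u, trivial_below m u -> trivial_below n (u ^ x).
Proof.
by exists `|(n%:Z + shift x)%R|%N => u; apply: trivial_belowJ; lia.
Qed.

Definition wreath_chain :=
  SubgroupChain trivial_below_subgroup trivial_below_decr trivial_below_conj.

Lemma wreath_cosetP n x y : coset wreath_chain n x y <->
  shift x = shift y /\
  forall k : int, (k < n%:Z + shift x)%R -> lamp x k = lamp y k.
Proof.
rewrite /coset /=; split=> -[/= sxy lxy]; (split=> [|k kn] /=; [lia|]).
  have := lxy (k - shift x)%R ltac:(lia).
  rewrite opprK subrK => e; apply/esym/(mulgI (lamp x k)^-1).
  by rewrite e mulVg.
by rewrite opprK lxy ?mulVg //; lia.
Qed.


Lemma wreath_separated x : (forall n, wreath_chain n x) -> x = 1.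
Proof.
move=> Ux; apply: wreathP => [|k]; first by have [] := Ux 0%N.
by have [_ ->] := Ux `|k|.+1; last lia.
Qed.

Lemma wreath_complete : chain_complete wreath_chain.
Proof.
move=> x xS; have xle := coherent_coset xS; set s := shift (x 0%N).
have xs n : shift (x n) = s.
  by have /wreath_cosetP[<-] := xle 0%N n (leq0n n).
have stable n m k : (n <= m)%N -> (k < n%:Z + s)%R ->
    lamp (x n) k = lamp (x m) k.
  by move=> nm kn; have /wreath_cosetP[_ ->] := xle n m nm; rewrite ?xs.
(* Any index [n] with [k < n + s] gives the same value at [k]. *)
pose f k := lamp (x `|(k - s)%R|.+1) k.
have fE n k : (k < n%:Z + s)%R -> f k = lamp (x n) k.
  move=> kn; rewrite /f; have [nk|kn'] := leqP n `|(k - s)%R|.+1.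
    by rewrite -(stable n).
  by apply: stable; [exact: ltnW | lia].
have bf : bounded_below f.
  have [N N0] := lamp_bounded (x 0%N); exists (Num.min N s) => k.
  by rewrite lt_min => /andP[kN ks]; rewrite (fE 0%N) ?N0 // add0r.
exists (Wreath s bf) => n; apply/wreath_cosetP; rewrite xs.
by split=> // k kn; rewrite /= (fE n).
Qed.

(** A code [((N, m), s)] for a lamp function with finite support: [s] lists the
values from position [N] onwards. The entry [m] is for [finite_wreath]. *)
Definition fill (a : int * int * seq D) (k : int) : D :=
  if (a.1.1 <= k)%R then nth 1 a.2 `|(k - a.1.1)%R|%N else 1.

Fact fill_bounded a : bounded_below (fill a).
Proof. by exists a.1.1 => k kN; rewrite /fill leNgt kN. Qed.

Definition finite_wreath a := Wreath a.1.2 (fill_bounded a).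

Lemma finite_wreath_dense x n :
  exists a, coset wreath_chain n x (finite_wreath a).
Proof.
have [N Nx] := lamp_bounded x.
pose L := `|(n%:Z + shift x - N)%R|%N.
exists (N, shift x, mkseq (fun i => lamp x (N + i%:Z)%R) L).
apply/wreath_cosetP; split=> // k kn; rewrite /= /fill /=.
have [Nk|kN] := leP N k; last exact: Nx.
by rewrite nth_mkseq; [congr lamp; lia | rewrite /L; lia].
Qed.

Lemma wreath_separable :
  countable [set: D] -> separable (chain_group wreath_chain).
Proof.
move=> cD; have cfin (T : Type) : countable [set: T] ->
    countable [set: int * int * seq T].
  by move=> /Pcountable[{}T ->].
apply: (@chain_separable _ wreath_chain (range finite_wreath)).
  exact: sub_countable (card_image_le _ _) (cfin _ cD).
by move=> x n; have [a xa] := finite_wreath_dense x n; exists (finite_wreath a).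
Qed.

Definition shift_by (m : int) := Wreath m wreath_one_bounded.

(** Translation by [n] carries the lamps at the positions [k >= 0] to those at
the positions [k >= n]. *)
Lemma wreath_conjugates n :
  exists x, conjugate (wreath_chain 0) x `<=` wreath_chain n.
Proof.
exists (shift_by n) => _ [u Uu <-]; rewrite -mulgA.
have := @trivial_belowJ 0 n (shift_by n)^-1 u.
by rewrite conjgE invgK; apply=> //=; lia.
Qed.

Fact step_bounded (n : nat) (d : D) :
  bounded_below (fun k => if (n%:Z <= k)%R then d else 1).
Proof. by exists (n%:Z)%R => k; rewrite ltNge => /negPf ->. Qed.

Definition step n d := Wreath 0%R (step_bounded n d).

Lemma step_chain n m d : (n <= m)%N -> wreath_chain n (step m d).
Proof.
move=> nm; split=> // k kn /=.
by case: leP => // mk; lia.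
Qed.

Lemma wreath_not_locally_compact (d : nat -> D) : injective d ->
  ~ locally_compact [set: chain_group wreath_chain].
Proof.
move=> dinj; apply: chain_not_locally_compact => n.
exists (fun i => step n (d i)) => [i|]; first exact: step_chain.
exists n.+1 => i j /wreath_cosetP[_ /(_ (n%:Z)%R)] /=.
by rewrite lexx => dij; apply/dinj/dij; lia.
Qed.

(** On the elements of shift 0, evaluating one lamp is a homomorphism to [D]. *)
Lemma lamp_eval_word (I : Type) (g : I -> wreath D) w k :
  (forall i, shift (g i) = 0%R) ->
  shift (eval_word g w) = 0%R /\
  lamp (eval_word g w) k = eval_word (fun i => lamp (g i) k) w.
Proof.
move=> g0; rewrite /eval_word; elim: w => [|[i b] w [IHs IHl]].
  by rewrite !big_nil.
by rewrite !big_cons /= -IHl; case: b; rewrite /= g0 IHs ?oppr0 subr0 ?addr0.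
Qed.

End Wreath.

(** * A free sequence converging to 1 *)

Section FreeSequence.

Notation F := (free_group nat).

Definition free_seq (i : nat) : wreath F := step i (gen i).

(** At position [n] every generator [x_i] with [i <= n] is present, so the lamp
there reads off the whole word. *)
Lemma lamp_free_lift_free_seq n (d : F) :
  all ((fun i => i <= n)%N \o fst) (word d) ->
  lamp (free_lift free_seq d) n = d.
Proof.
move=> /allP dn; have [//|_ ->] := @lamp_eval_word _ _ free_seq (word d) n.
apply: val_inj; rewrite -[RHS](eval_word_gen (word_reduced d)) /=; congr word.
apply: eq_big_seq => -[i b] /dn /= ni; rewrite lez_nat ni //.
Qed.

Lemma free_seq_inj n (d e : F) :
  all ((fun i => i <= n)%N \o fst) (word d) ->
  all ((fun i => i <= n)%N \o fst) (word e) ->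
  lamp (free_lift free_seq d) n = lamp (free_lift free_seq e) n -> d = e.
Proof. by move=> dn en; rewrite !lamp_free_lift_free_seq. Qed.

Lemma free_basis_free_seq : free_basis free_seq.
Proof.
move=> w redw w0 w1; pose d : F := FreeGroup redw.
suff d1 : d = 1 by apply: w0; rewrite -[w]/(word d) d1.
(* At this position all letters of [w] are visible. *)
pose n := \max_(a <- w) a.1.
apply: (@free_seq_inj n) => //.
  by apply/allP => a aw /=; exact: (@leq_bigmax_seq _ w xpredT fst a aw isT).
by rewrite [free_lift _ d]w1 free_lift1.
Qed.

(** Two elements of the generated subgroup in the same coset of the [n.+1]-st
chain subgroup agree at position [n], which determines them. *)
Lemma discrete_free_seq n : @discrete_subset (chain_group (wreath_chain F))
  (generated (free_seq @` `I_n)).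
Proof.
have gen_lift := @generated_free_lift _ _ free_seq (fun i => (i < n)%N).
have le_n (d : F) : all ((fun i => i < n)%N \o fst) (word d) ->
    all ((fun i => i <= n)%N \o fst) (word d).
  by apply: sub_all => a /ltnW.
move=> x Gx; split; first exact: mem_set.
exists (coset (wreath_chain F) n.+1 x); first exact: nbhs_coset.
apply/seteqP; split=> [y [xy Gy]|_ ->]; last by split=> //; exact: coset_refl.
move: xy; have [d /= /le_n dn <-] := gen_lift _ Gx.
have [e /= /le_n en <-] := gen_lift _ Gy.
move=> /wreath_cosetP[_ /(_ (n%:Z)%R)] lde; congr free_lift.
apply: (free_seq_inj en dn); apply/esym/lde.
have [//|-> _] := @lamp_eval_word _ _ free_seq (word d) n; lia.
Qed.

Lemma wreath_free_subgroup_at_1 :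
  free_subgroup_at_1 (chain_group (wreath_chain F)).
Proof.
exists free_seq; split.
- apply: cvg_chain => n; exists n => // i ni; rewrite /coset /= invg1 mul1g.
  exact: step_chain.
- exact: free_basis_free_seq.
- exists (free_seq 0%N), (free_seq 1%N); split; try exact: sub_gen_smallest.
  rewrite /commute.
  have fE i : free_seq i = free_lift free_seq (gen i).
    by rewrite /free_lift /eval_word big_seq1.
  rewrite !fE => /= c01.
  have := @free_seq_inj 1 (gen 0%N * gen 1%N) (gen 1%N * gen 0%N) isT isT.
  by rewrite !free_liftM c01 => /(_ erefl)/(congr1 (@word _)).
- exact: discrete_free_seq.
Qed.

End FreeSequence.

Theorem theorem1p5 (R : realType) :
  exists G : topologicalGroupType,
    [/\ polish R G,
        ~ locally_compact [set: G],
        weil_complete G,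
        free_subgroup_at_1 G
      & exists U : set G,
          [/\ open U, subgroup U
            & nbhs (1 : G) = filter_from [set: G] (conjugate U)]].
Proof.
pose F := free_group nat; pose U := wreath_chain F.
exists (chain_group U); split.
- split; first exact/wreath_separable/countableP.
  exact: chain_completely_metrizable (@wreath_separated F) (@wreath_complete F).
- by apply: (@wreath_not_locally_compact _ (@gen nat)) => i j [].
- exact/chain_weil_complete/wreath_complete.
- exact: wreath_free_subgroup_at_1.
- exists (U 0%N); split; first exact: chain_subgroup_open.
    exact: chain_subgroup.
  exact/nbhs1_conjugates/wreath_conjugates.
Qed.
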